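(* Let $d \geq 1$ be an integer and let $Q \subset \mathbb{R}^d$ be a convex polytope in John's position. Then there exists a subset of at most $2d$ vertices of $Q$ whose convex hull $Q'$ satisfies $$Q \subseteq -2 d^2 \, Q'.$$
   Context: A convex body $K \subset \mathbb{R}^d$ (compact convex set with non-empty interior) is in John's position if the largest volume ellipsoid inscribed in (contained in) $K$ is the Euclidean unit ball $B^d$ centered at the origin. For a set $A \subset \mathbb{R}^d$ and a real number $t$, $tA = \{ t a : a \in A\}$. A convex polytope is the convex hull of finitely many points. *)

(* Defs.v *)
From HB Require Import structures.
From mathcomp Require Import all_boot all_order all_algebra.
From mathcomp Require Import all_classical all_reals all_analysis.

Set Implicit Arguments.
Unset Strict Implicit.
Unset Printing Implicit Defensive.

Import Order.TTheory GRing.Theory Num.Theory.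
Import numFieldNormedType.Exports.

Local Open Scope classical_set_scope.
Local Open Scope ring_scope.

(* The library norm on matrices is the sup norm, hence the explicit Euclidean
   one; the topology of 'rV[R]_d is the same for both. *)
Definition l2norm (R : realType) (d : nat) (x : 'rV[R]_d) : R :=
  Num.sqrt (\sum_(i < d) x 0 i ^+ 2).

Definition unit_ball (R : realType) (d : nat) : set 'rV[R]_d :=
  [set x | l2norm x <= 1].
Arguments unit_ball : clear implicits.

(* d-dimensional Lebesgue measure, as the iterated product of the Lebesgue
   measure on R: the recursive clause is product_measure1 read through the
   identification of 'rV_n.+1 with R * 'rV_n. It is a total function; like
   product_measure1 it is meaningful on measurable sets only. *)
Fixpoint volume (R : realType) (d : nat) : set 'rV[R]_d -> \bar R :=
  match d with
  | 0 => fun A => (\1_A 0)%:E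
  | n.+1 => fun A =>
      (\int[lebesgue_measure]_t
         volume [set y : 'rV[R]_n | A (row_mx (t%:M : 'rV[R]_1) y)])%E
  end.

Definition convex_hull (R : realType) (d : nat) (A : set 'rV[R]_d) :
    set 'rV[R]_d :=
  smallest (@convex_set R 'rV[R]_d) A.

Definition convex_body (R : realType) (d : nat) (K : set 'rV[R]_d) : Prop :=
  [/\ convex_set (K : set (convex_lmodType 'rV[R]_d)), compact K
    & K° !=set0].

Definition polytope (R : realType) (d : nat) (Q : set 'rV[R]_d) : Prop :=
  exists2 V : set 'rV[R]_d, finite_set V & Q = convex_hull V.

(* For a polytope, the extreme points are the vertices. *)
Definition vertices (R : realType) (d : nat) (Q : set 'rV[R]_d) :
    set 'rV[R]_d :=
  [set v | Q v /\ forall (x y : 'rV[R]_d) (t : R), Q x -> Q y ->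
     0 < t -> t < 1 -> v = t *: x + (1 - t) *: y -> x = v /\ y = v].

Definition ellipsoid (R : realType) (d : nat) (E : set 'rV[R]_d) : Prop :=
  exists (M : 'M[R]_d) (c : 'rV[R]_d),
    M \in unitmx /\ E = [set x *m M + c | x in unit_ball R d].

Definition largest_volume_ellipsoid (R : realType) (d : nat)
    (K E : set 'rV[R]_d) : Prop :=
  [/\ ellipsoid E, E `<=` K
    & forall E', ellipsoid E' -> E' `<=` K -> (volume E' <= volume E)%E].

Definition john_position (R : realType) (d : nat) (K : set 'rV[R]_d) : Prop :=
  convex_body K /\ largest_volume_ellipsoid K (unit_ball R d).

Definition dilate (R : realType) (d : nat) (t : R) (A : set 'rV[R]_d) :
    set 'rV[R]_d :=
  [set t *: a | a in A].

(* Main.v *)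
Require Import Defs.
From HB Require Import structures.
From mathcomp Require Import all_boot all_order all_algebra.
From mathcomp Require Import all_classical all_reals all_analysis.
From mathcomp Require Import measurable_realfun.
From mathcomp Require Import ring lra.

(** Being in John's position is used only through the inclusions B <= Q <= d B,
    where B is the unit ball; they give -(1/d) Q <= B <= Q.

    The second inclusion ([john_sub_ball]): if some p in Q had norm r > d, the
    convex hull of B and p, which Q contains, would contain an ellipsoid of larger
    volume than B, obtained from B by stretching it slightly towards p and
    shrinking it in the orthogonal directions. To compare volumes one needs that
    the ellipsoid B M + c has |det M| times the volume of B
    ([volume_affine_ball]). As B is invariant under rotations, M may be replaced
    by H M with H orthogonal, and a suitable reflection H makes H M block
    triangular. The slices of the ellipsoid are then ellipsoids of lower
    dimension, and the formula follows by induction from the iterated integral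
    that defines the volume.

    The rest is linear algebra ([sparse_reflected_hull]). Choose d vertices
    v_1, ..., v_d of Q that maximise the absolute value of their determinant. By
    Cramer's rule every x in Q is sum_i be_i v_i with |be_i| <= 1
    ([max_det_parallelotope]). The point q = - (1/d^2) sum_i v_i is in Q, hence a
    nonnegative combination sum_j b_j w_j of at most d vertices w_j with total
    weight at most 1 ([conic_caratheodory]). Let Q' be the convex hull of the v_i
    and the w_j. It contains 0, because q points opposite to sum_i v_i. With
    m = max (0, max_i be_i),
      x = - (sum_i (m - be_i) v_i + m d^2 sum_j b_j w_j),
    where the coefficients in the parentheses are nonnegative and add up to at
    most 2 (d - 1) + d^2 <= 2 d^2; hence x is in -2 d^2 Q'.

    That Q is the convex hull of its extreme points is obtained by writing Q as
    the hull of the fewest possible points ([polytope_vertex_matrix]). *)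

Set Implicit Arguments.
Unset Strict Implicit.
Unset Printing Implicit Defensive.

Import Order.TTheory GRing.Theory Num.Theory.
Import numFieldNormedType.Exports.
Local Open Scope classical_set_scope.
Local Open Scope ring_scope.

(** * Affine substitution in one variable *)

(** The image of Lebesgue measure under s |-> (s - c) / l is l times Lebesgue
    measure, because both agree on half-open intervals. *)
Lemma ge0_integral_affine (R : realType) (l c : R) (f : R -> \bar R) :
  0 < l -> measurable_fun [set: R] f -> (forall x, 0 <= f x)%E ->
  (\int[lebesgue_measure]_s f ((s - c) / l)%R =
   l%:E * \int[lebesgue_measure]_t f t)%E.
Proof.
move=> l0 mf f0.
pose phi : measurableTypeR R -> measurableTypeR R := fun s => (s - c) / l.
have mphi : measurable_fun [set: measurableTypeR R] phi.
  apply: measurable_funM; last exact: measurable_cst.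
  by apply: measurable_funB; [exact: measurable_id|exact: measurable_cst].
have li0 : 0 <= l^-1 by rewrite invr_ge0 ltW.
(* Typing [m] as a measure makes the measurability of [phi] an argument of
   [nu]. *)
pose mscaled_image (m : {measure set (measurableTypeR R) -> \bar R}) :
  {measure set (measurableTypeR R) -> \bar R} := mscale (NngNum li0) m.
pose nu := mscaled_image (pushforward (@lebesgue_measure R) phi).
have nuE A : measurable A -> lebesgue_measure A = nu mphi A.
  move: A; apply: lebesgue_measure_unique => _ [[a b]] _ <-.
  rewrite /nu /mscaled_image /= /mscale /= /pushforward.
  have -> : phi @^-1` `]a, b] = `](l * a + c), (l * b + c)]%classic.
    apply/seteqP; split => x /=;
      rewrite !in_itv/= /phi ltr_pdivlMr// ler_pdivrMr//;
      by move=> /andP[h1 h2]; apply/andP; split; lra.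
  rewrite !lebesgue_measure_itv/= !lte_fin ltrD2r ltr_pM2l//.
  case: ifPn => _; last by rewrite mule0.
  rewrite -!EFinB -EFinM; congr EFin; field; exact: lt0r_neq0.
have -> : (\int[lebesgue_measure]_t f t = \int[nu mphi]_t f t)%E.
  by apply: eq_measure_integral => A mA _; exact: nuE.
rewrite ge0_integral_mscale//= muleA -EFinM divff ?gt_eqF// mul1e.
by rewrite ge0_integral_pushforward.
Qed.

(** * Euclidean norm and rotations *)

Definition sqn (R : realType) (n : nat) (x : 'rV[R]_n) : R :=
  \sum_(i < n) x 0 i ^+ 2.

Lemma sqn_ge0 (R : realType) (n : nat) (x : 'rV[R]_n) : 0 <= sqn x.
Proof. by apply: sumr_ge0 => i _; exact: sqr_ge0. Qed.

Lemma sqn_eq0 (R : realType) (n : nat) (x : 'rV[R]_n) : sqn x = 0 -> x = 0.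
Proof.
move=> /eqP; rewrite psumr_eq0; last by move=> i _; exact: sqr_ge0.
move=> /allP h; apply/rowP => i; apply/eqP.
by have := h i (mem_index_enum i); rewrite /= sqrf_eq0 mxE.
Qed.

Lemma sqnE (R : realType) (n : nat) (x : 'rV[R]_n) : sqn x = (x *m x^T) 0 0.
Proof. by rewrite mxE; apply: eq_bigr => i _; rewrite mxE expr2. Qed.

Lemma sqnZ (R : realType) (n : nat) (a : R) (x : 'rV[R]_n) :
  sqn (a *: x) = a ^+ 2 * sqn x.
Proof. by rewrite mulr_sumr; apply: eq_bigr => i _; rewrite mxE exprMn. Qed.

Lemma sqn_row_mx (R : realType) (n : nat) (a : R) (x : 'rV[R]_n) :
  sqn (row_mx (a%:M : 'rV[R]_1) x) = a ^+ 2 + sqn x.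
Proof.
rewrite /sqn (@big_split_ord _ _ _ 1 n)/= big_ord1 row_mxEl mxE/= mulr1n.
by congr (_ + _); apply: eq_bigr => i _; rewrite row_mxEr.
Qed.

Lemma unit_ballE (R : realType) (n : nat) (x : 'rV[R]_n) :
  unit_ball R n x = (sqn x <= 1) :> Prop.
Proof.
rewrite /unit_ball /l2norm /= -/(sqn x) -{1}sqrtr1.
by rewrite ler_psqrt ?qualifE/= ?sqn_ge0.
Qed.

Lemma sqn_orthogonal (R : realType) (n : nat) (H : 'M[R]_n) (x : 'rV[R]_n) :
  H *m H^T = 1%:M -> sqn (x *m H) = sqn x.
Proof. by move=> HH; rewrite !sqnE trmx_mul mulmxA -(mulmxA x) HH mulmx1. Qed.

Lemma det_orthogonal (R : realType) (n : nat) (H : 'M[R]_n) :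
  H *m H^T = 1%:M -> `|\det H| = 1.
Proof.
move=> /(congr1 determinant); rewrite det_mulmx det_tr det1 -expr2 => /eqP.
by rewrite sqrf_eq1 => /orP[]/eqP->; rewrite ?normrN normr1.
Qed.

(** The matrix is the Householder reflection in the hyperplane orthogonal to
    u - e_0; it exchanges the two unit vectors e_0 and u. *)
Lemma orthogonal_moves_e0 (R : realType) (n : nat) (u : 'rV[R]_n.+1) :
  sqn u = 1 -> exists H : 'M[R]_n.+1, H *m H^T = 1%:M /\ delta_mx 0 0 *m H = u.
Proof.
move=> u1.
pose e : 'rV[R]_n.+1 := delta_mx 0 0.
have [->|ue] := eqVneq u e.
  by exists 1%:M; rewrite trmx1 !mulmx1.
pose v := u - e; have vE : v = u - e by [].
have uu : u *m u^T = 1%:M.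
  by apply/matrixP => i j; rewrite !ord1 -sqnE u1 mxE.
have ee : e *m e^T = 1%:M.
  by rewrite /e trmx_delta mul_delta_mx; apply/matrixP => i j; rewrite !ord1 !mxE.
have ue' : u *m e^T = (u 0 0)%:M.
  by rewrite /e trmx_delta -colE; apply/matrixP => i j; rewrite !ord1 !mxE.
have eu' : e *m u^T = (u 0 0)%:M.
  by rewrite -[LHS]trmxK trmx_mul trmxK ue' tr_scalar_mx.
have vv : v *m v^T = (2 - 2 * u 0 0)%:M.
  rewrite /v linearB/= mulmxBl !mulmxBr uu ee ue' eu'.
  by rewrite -!raddfB; congr (_%:M); ring.
have ev : e *m v^T = (u 0 0 - 1)%:M.
  by rewrite /v linearB/= mulmxBr ee eu' -!raddfB.
have v0 : 2 - 2 * u 0 0 != 0.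
  apply: contra ue => /eqP s0; rewrite -subr_eq0 -vE.
  by apply/eqP/sqn_eq0; rewrite sqnE vv s0 mxE.
clearbody v; pose k := 2 / (2 - 2 * u 0 0).
exists (1%:M - k *: (v^T *m v)); split.
  have -> : (1%:M - k *: (v^T *m v))^T = 1%:M - k *: (v^T *m v).
    by rewrite [LHS]linearB/= trmx1 [X in _ - X]linearZ/= trmx_mul trmxK.
  rewrite mulmxBl !mulmxBr !mulmx1 !mul1mx -scalemxAl -scalemxAr.
  rewrite (mulmxA (v^T *m v)) -(mulmxA v^T v v^T) vv mul_mx_scalar -scalemxAl.
  rewrite !scalerA -addrA -opprD -[RHS]subr0; congr (_ - _).
  rewrite -scalerBl -scalerDl.
  have -> : k + (k - k * k * (2 - 2 * u 0 0)) = 0 by rewrite /k; field.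
  by rewrite scale0r.
rewrite mulmxBr mulmx1 -scalemxAr mulmxA ev mul_scalar_mx scalerA.
have -> : k * (u 0 0 - 1) = - 1 by rewrite /k; field.
by rewrite scaleN1r opprK vE addrC subrK.
Qed.

(** * Volume of ellipsoids *)

(** Volume of the Euclidean n-ball of squared radius rho, in units of the
    volume of the unit ball. The squared radius is the parameter since slicing
    at height t turns rho into rho - t ^+ 2, possibly negative; for rho = 0 the
    ball is a point, of volume 1 exactly when n = 0, as 0 ^+ 0 = 1. *)
Definition radial_volume (R : realType) (n : nat) (rho : R) : R :=
  if rho < 0 then 0 else Num.sqrt rho ^+ n.

Lemma radial_volume_ge0 (R : realType) (n : nat) (rho : R) :
  0 <= radial_volume n rho.
Proof.
by rewrite /radial_volume; case: ifP => // _; rewrite exprn_ge0 ?sqrtr_ge0.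
Qed.

Lemma radial_volume_scale (R : realType) (n : nat) (rho t : R) : 0 < rho ->
  radial_volume n (rho * t) = Num.sqrt rho ^+ n * radial_volume n t.
Proof.
move=> r0; rewrite /radial_volume pmulr_rlt0//.
case: ifP => _; first by rewrite mulr0.
by rewrite sqrtrM ?exprMn// ltW.
Qed.

Lemma measurable_radial_slice (R : realType) (n : nat) (rho : R) :
  measurable_fun [set: R] (fun t => (radial_volume n (rho - t ^+ 2))%:E).
Proof.
apply/measurable_EFinP.
have mq : measurable_fun [set: R] (fun t : R => rho - t ^+ 2).
  apply: measurable_funB; first exact: measurable_cst.
  exact: measurable_funX.
rewrite /radial_volume; apply: measurable_fun_ifT.
- by apply: measurable_fun_ltr => //; exact: measurable_cst.
- exact: measurable_cst.
- have ms : measurable_fun [set: R] (fun t : R => Num.sqrt (rho - t ^+ 2)).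
    apply: (measurableT_comp (f := @Num.sqrt R)) => //.
    by apply: continuous_measurable_fun; exact: sqrt_continuous.
  exact: measurable_funX.
Qed.

(** Cavalieri for balls. The constant is the integral for rho = 1, finite since
    the integrand is at most 1 and vanishes off [-1, 1], and positive since the
    integrand is at least (1/2)^n on [0, 1/2]. The case rho > 0 follows by
    scaling t with the square root of rho, and for rho = 0 the integrand lives
    on a single point. *)
Lemma integral_radial_slice (R : realType) (n : nat) :
  exists2 k : R, 0 < k & forall rho : R,
  (\int[lebesgue_measure]_t (radial_volume n (rho - t ^+ 2))%:E =
   (k * radial_volume n.+1 rho)%:E)%E.
Proof.
pose I : \bar R :=
  (\int[lebesgue_measure]_t (radial_volume n (1 - t ^+ 2)%R)%:E)%E.
have I_lt : (I < +oo)%E.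
  have -> : I = (\int[lebesgue_measure]_(t in (`[(- 1)%R, 1%R]%classic : set R))
                   (radial_volume n (1 - t ^+ 2)%R)%:E)%E.
    rewrite [RHS]integral_mkcond; apply: eq_integral => t _.
    rewrite patchE; case: ifPn => //; rewrite notin_setE/= in_itv/= => t1.
    rewrite /radial_volume ifT// subr_lt0 ltNge; apply: contra_notN t1 => t1.
    by rewrite -ler_norml -(@ler_pXn2r _ 2)// ?nnegrE// expr1n real_normK ?num_real.
  apply: (@le_lt_trans _ _ (\int[lebesgue_measure]_(t in
    (`[(- 1)%R, 1%R]%classic : set R)) (cst 1%:E) t)%E).
    apply: ge0_le_integral => //.
    - by move=> t _; rewrite lee_fin radial_volume_ge0.
    - by apply: measurable_funTS; exact: measurable_radial_slice.
    - move=> t _; rewrite lee_fin /radial_volume; case: ifPn => //.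
      rewrite -leNgt subr_ge0 => t1; apply: exprn_ile1; first exact: sqrtr_ge0.
      rewrite -[X in _ <= X]sqrtr1; apply: ler_wsqrtr.
      by rewrite gerBl sqr_ge0.
  rewrite integral_cst//= lebesgue_measure_itv/=.
  by case: ifP => _; rewrite -?EFinB mul1e ltry.
have I_gt : (0 < I)%E.
  have mI : measurable (`[0, (1/2)]%classic : set R) by [].
  apply: (@lt_le_trans _ _ (\int[lebesgue_measure]_(t in
    (`[0%R, (1/2)%R]%classic : set R)) (cst ((1 / 2) ^+ n)%:E) t)%E).
    rewrite integral_cst//= lebesgue_measure_itv/= lte_fin.
    rewrite divr_gt0// -EFinB -EFinM lte_fin subr0 mulr_gt0 ?exprn_gt0 ?divr_gt0//.
  apply: (@le_trans _ _ (\int[lebesgue_measure]_(t in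
    (`[0%R, (1/2)%R]%classic : set R)) (radial_volume n (1 - t ^+ 2)%R)%:E)%E).
    apply: ge0_le_integral => //. 
    - by move=> t _; rewrite lee_fin exprn_ge0// divr_ge0.
    - by apply: measurable_funTS; exact: measurable_radial_slice.
    - move=> t /=; rewrite in_itv/= => /andP[t0 t1].
      have t4 : (1 / 2) ^+ 2 <= 1 - t ^+ 2.
        have : t * t <= 1 / 2 * (1 / 2) by apply: ler_pM.
        rewrite !expr2; lra.
      rewrite lee_fin /radial_volume ltNge (le_trans _ t4) ?sqr_ge0//=.
      apply: lerXn2r; rewrite ?nnegrE ?sqrtr_ge0 ?divr_ge0//.
      rewrite -[X in X <= _](@ger0_norm _ (1 / 2)) ?divr_ge0//.
      by rewrite -sqrtr_sqr ler_wsqrtr.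
  apply: ge0_subset_integral => //; first exact: measurable_radial_slice.
  by move=> t _; rewrite lee_fin radial_volume_ge0.
have IE : (I = (fine I)%:E)%E by rewrite fineK// ge0_fin_numE// ltW.
exists (fine I); first by rewrite -lte_fin -IE.
move=> rho; have [r0|r0|->] := ltgtP rho 0.
- rewrite integral0_eq.
    by rewrite /radial_volume r0 mulr0.
  move=> t _; rewrite /radial_volume.
  by rewrite (le_lt_trans _ r0)// gerBl sqr_ge0.
- have sr : 0 < Num.sqrt rho by rewrite sqrtr_gt0.
  have I_scale := ge0_integral_affine 0 sr (measurable_radial_slice n 1).
  rewrite -/I in I_scale.
  transitivity (\int[lebesgue_measure]_t ((Num.sqrt rho ^+ n)%:E *
      (radial_volume n (1 - ((t - 0) / Num.sqrt rho) ^+ 2))%:E))%E.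
    apply: eq_integral => t _; rewrite -EFinM -radial_volume_scale//; congr (_ _)%:E.
    rewrite subr0 mulrBr mulr1 expr_div_n sqr_sqrtr ?ltW//.
    by rewrite mulrCA divff ?mulr1// gt_eqF.
  rewrite ge0_integralZl_EFin//.
  2: by move=> t _; rewrite lee_fin radial_volume_ge0.
  2: apply: (measurableT_comp (measurable_radial_slice n 1)).
  2: by apply: measurable_funM => //; apply: measurable_funB.
  rewrite I_scale; last by move=> t; rewrite lee_fin radial_volume_ge0.
  rewrite IE -!EFinM; congr EFin; rewrite -[in RHS](mulr1 rho) radial_volume_scale//.
  rewrite /radial_volume ltr10 sqrtr1 expr1n exprSr; ring.
- transitivity (\int[lebesgue_measure]_(t in [set 0%R])
    (radial_volume n ((0 : R) - t ^+ 2)%R)%:E)%E.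
    rewrite [RHS]integral_mkcond; apply: eq_integral => t _.
    rewrite patchE; case: ifPn => //; rewrite notin_setE/= => /eqP t0.
    by rewrite /radial_volume sub0r oppr_lt0 exprn_even_gt0//= t0.
  by rewrite integral_set1 /radial_volume ltxx sqrtr0 expr0n mulr0.
Qed.

Definition affine_ball (R : realType) (n : nat) (M : 'M[R]_n) (c : 'rV[R]_n)
    (rho : R) : set 'rV[R]_n :=
  [set x *m M + c | x in [set x | sqn x <= rho]].

Lemma affine_ball_rotate (R : realType) (n : nat) (H M : 'M[R]_n)
    (c : 'rV[R]_n) (rho : R) :
  H *m H^T = 1%:M -> affine_ball (H *m M) c rho = affine_ball M c rho.
Proof.
move=> HH; apply/seteqP; split => _ [x /= xr <-].
  by exists (x *m H); rewrite /= ?sqn_orthogonal// mulmxA.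
have HTH : H^T *m H = 1%:M by exact: mulmx1C.
exists (x *m H^T); first by rewrite /= sqn_orthogonal// trmxK.
by rewrite mulmxA -(mulmxA x) HTH mulmx1.
Qed.

(** One step of the QR decomposition: the rotation sends the first column of M
    to a positive multiple of the first basis vector. *)
Lemma rotate_first_column (R : realType) (n : nat) (M : 'M[R]_(1 + n)) :
  M \in unitmx ->
  exists (H : 'M[R]_(1 + n)) (l : R) (v : 'rV[R]_n) (N : 'M[R]_n),
  [/\ H *m H^T = 1%:M, 0 < l & H *m M = block_mx l%:M v 0 N].
Proof.
move=> Mu; pose e : 'cV[R]_(1 + n) := delta_mx 0 0.
pose w := lsubmx M; have we : w = M *m e.
  rewrite -colE; apply/matrixP => i j; rewrite !mxE ord1; congr (M _ _).
  exact: val_inj.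
pose s := sqn w^T; have s0 : 0 < s.
  rewrite lt_def sqn_ge0 andbT; apply/eqP => /sqn_eq0 wz.
  have : e = 0 by rewrite -(mulKmx Mu e) -we -[w]trmxK wz trmx0 mulmx0.
  by move=> /matrixP/(_ 0 0); rewrite !mxE !eqxx => /eqP; rewrite oner_eq0.
have ss0 : 0 < Num.sqrt s by rewrite sqrtr_gt0.
have [] := @orthogonal_moves_e0 R n ((Num.sqrt s)^-1 *: w^T).
  by rewrite sqnZ exprVn sqr_sqrtr ?ltW// -/s mulVf// gt_eqF.
move=> H0; pose H : 'M[R]_(1 + n) := H0; change H0 with H => -[HH eH].
exists H, (Num.sqrt s), (ursubmx (H *m M)), (drsubmx (H *m M)).
split=> //; have Hw : H *m w = Num.sqrt s *: e.
  rewrite -[w]trmxK -[w^T](scalerKV (lt0r_neq0 ss0)) -eH linearZ/= -scalemxAr.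
  by rewrite trmx_mul mulmxA HH mul1mx trmx_delta.
rewrite -[LHS](@submxK _ 1 n 1 n); congr block_mx.
- have -> : ulsubmx (H *m M) = usubmx (H *m w).
    by rewrite /w mulmx_lsub; apply/matrixP => i j; rewrite !mxE.
  by rewrite Hw; apply/matrixP => i j; rewrite !ord1 !mxE !eqxx mulr1 mulr1n.
- have -> : dlsubmx (H *m M) = dsubmx (H *m w).
    by rewrite /w mulmx_lsub; apply/matrixP => i j; rewrite !mxE.
  by rewrite Hw; apply/matrixP => i j; rewrite !ord1 !mxE/= mulr0.
Qed.

(** For a block triangular matrix the first coordinate s of the image depends on
    the first coordinate t of the ball alone, and the remaining coordinates of
    the ball at height t form a ball of squared radius rho - t ^+ 2. *)
Lemma slice_affine_ball (R : realType) (n : nat) (l : R) (v : 'rV[R]_n)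
    (N : 'M[R]_n) (c : 'rV[R]_(1 + n)) (rho s : R) : 0 < l ->
  let t := (s - lsubmx c 0 0) / l in
  [set y | affine_ball (block_mx l%:M v 0 N) c rho (row_mx (s%:M : 'rV[R]_1) y)] =
  affine_ball N (t *: v + rsubmx c) (rho - t ^+ 2).
Proof.
move=> l0 t.
have cE : c = row_mx ((lsubmx c 0 0)%:M : 'M[R]_1) (rsubmx c).
  rewrite -{1}[c]hsubmxK; congr row_mx.
  by apply/matrixP => i j; rewrite !ord1 [RHS]mxE mulr1n.
apply/seteqP; split => [y [x /= xr xy]|_ [z /= zr <-]].
  move: xr xy; rewrite -[x]hsubmxK cE (_ : lsubmx x = (lsubmx x 0 0)%:M); last first.
    by apply/matrixP => i j; rewrite !ord1 [RHS]mxE mulr1n.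
  move: (lsubmx x 0 0) (rsubmx x) => xi z.
  rewrite sqn_row_mx mul_row_block add_row_mx -scalar_mxM mulmx0 addr0 => xr.
  move=> /eq_row_mx[/matrixP/(_ 0 0)]; rewrite !mxE !mulr1n => sE <-.
  have -> : t = xi by rewrite /t mxE -sE; field; exact: lt0r_neq0.
  by exists z; rewrite /= ?lerBrDl// row_mxKr mul_scalar_mx addrCA addrA.
exists (row_mx (t%:M : 'rV[R]_1) z); first by rewrite /= sqn_row_mx -lerBrDl.
rewrite [X in _ + X]cE mul_row_block add_row_mx mulmx0 addr0 -scalar_mxM -raddfD/=.
congr row_mx; first by congr (_%:M); rewrite /t; field; exact: lt0r_neq0.
by rewrite mul_scalar_mx addrCA addrA.
Qed.

(** Induction on the dimension. Rotating the ball leaves the ellipsoid unchanged,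
    so the matrix may be taken block triangular; every slice is then an
    ellipsoid to which the induction hypothesis applies, and only an affine
    substitution in the slicing variable is left. The multiplicativity of the
    volume in |det M| thus needs no Fubini theorem. *)
Lemma volume_affine_ball (R : realType) (n : nat) :
  exists2 k : R, 0 < k & forall (M : 'M[R]_n) (c : 'rV[R]_n) (rho : R),
  M \in unitmx ->
  volume (affine_ball M c rho) = (`|\det M| * k * radial_volume n rho)%:E.
Proof.
elim: n => [|n [k k0 IH]].
  exists 1 => // M c rho _.
  rewrite /= det_mx00 normr1 !mul1r /radial_volume expr0 indicE.
  congr (_%:E); case: ltP => r0.
    rewrite (_ : _ \in _ = false)//; apply/negbTE; rewrite notin_setE => -[x /= xr _].
    by move: r0; rewrite ltNge (le_trans (sqn_ge0 _) xr).
  rewrite (_ : _ \in _ = true)//; apply/mem_set; exists 0; last by rewrite !thinmx0.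
  by rewrite /= /sqn big_ord0.
have [k' k'0 kE] := integral_radial_slice R n.
exists (k * k'); first exact: mulr_gt0.
move=> M c rho Mu.
have [H [l [v [N [HH l0 HM]]]]] := @rotate_first_column R n M Mu.
rewrite -(affine_ball_rotate _ _ _ HH) HM.
have dM : `|\det M| = l * `|\det N|.
  have : `|\det (H *m M)| = l * `|\det N|.
    by rewrite HM (@det_ublock _ 1 n) det_scalar1 normrM gtr0_norm.
  by rewrite det_mulmx normrM (det_orthogonal HH) mul1r.
have Nu : N \in unitmx.
  move: Mu; rewrite !unitmxE !unitfE -normr_eq0 dM.
  by apply: contraNN => /eqP->; rewrite normr0 mulr0.
rewrite /=.
under eq_integral => s _ do rewrite (slice_affine_ball _ _ _ _ _ l0) IH// EFinM.
rewrite (@ge0_integral_affine _ l (lsubmx (c : 'rV[R]_(1 + n)) 0 0)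
  (fun t => (`|\det N| * k)%:E * (radial_volume n (rho - t ^+ 2)%R)%:E)%E)//.
- rewrite ge0_integralZl_EFin//.
  + by rewrite kE -!EFinM dM; congr (_%:E); ring.
  + by move=> t _; rewrite lee_fin radial_volume_ge0.
  + exact: measurable_radial_slice.
  + by rewrite mulr_ge0// ltW.
- by apply: measurable_funeM; exact: measurable_radial_slice.
- by move=> t; rewrite -EFinM lee_fin !mulr_ge0// ?radial_volume_ge0// ltW.
Qed.

(** * Bodies in John's position lie in the ball of radius d *)

Lemma convex_set_segment (R : realType) (n : nat) (Q : set 'rV[R]_n) :
  convex_set (Q : set (convex_lmodType 'rV[R]_n)) ->
  forall (x y : 'rV[R]_n) (t : R), Q x -> Q y -> 0 <= t -> t <= 1 ->
  Q (t *: x + (1 - t) *: y).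
Proof.
move=> cQ x y t Qx Qy t0 t1.
have t01 : Itv.spec (@Itv.num_sem R) (Itv.Real `[Posz 0, Posz 1]) t.
  by rewrite /= /Itv.num_sem /= num_real/= in_itv/= t0 t1.
have := cQ x y (Itv.mk t01) (mem_set Qx) (mem_set Qy).
by move=> /set_mem.
Qed.

Lemma bernoulli (R : realType) (n : nat) (s : R) :
  0 <= s -> s <= 1 -> 1 - n%:R * s <= (1 - s) ^+ n.
Proof.
move=> s0 s1; elim: n => [|n IH]; first by rewrite mul0r subr0 expr0.
rewrite exprS -natr1.
apply: (@le_trans _ _ ((1 - s) * (1 - n%:R * s))).
  have : 0 <= n%:R * (s * s) by rewrite !mulr_ge0.
  lra.
by apply: ler_wpM2l => //; rewrite subr_ge0.
Qed.

(** The left factor is the long semi-axis of the ellipsoid of [john_sub_ball],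
    the square root is each of its n short semi-axes. To first order in tau the
    square of the product is 1 + 2 (r - 1 - n) tau, so that small values of tau
    work as soon as n + 1 < r; the second-order loss 4 n (r - 1) tau^2 is less
    than half of the gain for the given tau. *)
Lemma stretched_ellipsoid_bigger (R : realType) (n : nat) (r tau : R) :
  n.+1%:R < r -> tau = (r - n.+1%:R) / (4 * n.+1%:R * r) ->
  [/\ 0 < tau, 2 * tau < 1 &
   1 < (1 + (r - 1) * tau) * Num.sqrt (1 - 2 * tau) ^+ n].
Proof.
move=> nr tauE.
have d1 : 1 <= n.+1%:R :> R by rewrite ler1n.
have r0 : 0 < r by rewrite (lt_trans _ nr).
have dr : 0 < n.+1%:R * r by rewrite mulr_gt0.
have tau0 : 0 < tau by rewrite tauE divr_gt0 ?subr_gt0// -mulrA mulr_gt0.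
have eq : 4 * (n.+1%:R * r * tau) = r - n.+1%:R.
  by rewrite tauE; field; rewrite !gt_eqF// (lt_le_trans _ d1).
have tr : r * tau <= n.+1%:R * r * tau.
  by rewrite -mulrA ler_peMl// mulr_ge0// ltW.
have t1 : 4 * tau < 1.
  have : 4 * (r * tau) < r * 1 by lra.
  by rewrite mulrCA ltr_pM2l.
split=> //; first lra.
set a := 1 + _; set b := Num.sqrt _.
have a0 : 0 < a by rewrite /a addr_gt0// mulr_gt0// subr_gt0; lra.
rewrite -(@ltr_pXn2r _ 2) ?nnegrE// ?mulr_ge0 ?exprn_ge0 ?sqrtr_ge0 ?(ltW a0)//.
rewrite expr1n exprMn exprAC sqr_sqrtr; last lra.
have B := @bernoulli R n (2 * tau) (ltac:(lra)) (ltac:(lra)).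
apply: lt_le_trans (ler_wpM2l (sqr_ge0 a) B).
have nE : n.+1%:R = n%:R + 1 :> R by rewrite natr1.
have n0 : 0 <= n%:R :> R by [].
have ntau : n%:R * tau <= r * tau by rewrite ler_pM2r//; lra.
have ntau1 : 2 * (n%:R * tau) < 1.
  have : n%:R * tau * r * 4 <= r - n.+1%:R.
    rewrite -eq nE; have : 0 <= r * tau by rewrite mulr_ge0// ltW.
    lra.
  move=> h; rewrite -(ltr_pM2r r0); lra.
have q0 : 0 <= ((r - 1) * tau) ^+ 2 by exact: sqr_ge0.
apply: (@lt_le_trans _ _
  ((1 + 2 * ((r - 1) * tau)) * (1 - n%:R * (2 * tau)))); last first.
  by apply: ler_wpM2r; rewrite /a ?expr2 in q0 *; lra.
have key : 2 * n%:R * (r - 1) * tau < r - n.+1%:R.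
  have : 0 <= n%:R * r * tau by rewrite !mulr_ge0// ltW.
  have : 0 <= n%:R * tau by rewrite !mulr_ge0// ltW.
  have : 0 < r * tau by rewrite mulr_gt0.
  move: eq; rewrite nE; lra.
have : 0 < tau * ((r - n.+1%:R) - 2 * n%:R * (r - 1) * tau).
  by rewrite mulr_gt0// subr_gt0.
rewrite nE; lra.
Qed.

(** Here xi and w are the first coordinate and the squared norm of the remaining
    coordinates of a point of the unit ball. Its image in the ellipsoid of
    [john_sub_ball] is (1 - t) z + t p with t = tau (1 + xi), and the inequality
    says that z is in the unit ball. The coefficient t vanishes at xi = -1, where
    the ellipsoid touches the ball. *)
Lemma stretched_ellipsoid_sub (R : realType) (r tau xi w : R) :
  0 < tau -> 2 * tau < 1 -> -1 <= xi -> xi <= 1 -> xi ^+ 2 + w <= 1 ->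
  ((1 + (r - 1) * tau) * xi + (r - 1) * tau - tau * (1 + xi) * r) ^+ 2
    + (1 - 2 * tau) * w <= (1 - tau * (1 + xi)) ^+ 2.
Proof.
move=> tau0 tau1 xi0 xi1 xw.
have h1 : 0 <= (1 - 2 * tau) * (1 - xi ^+ 2 - w).
  by rewrite mulr_ge0//; lra.
have h2 : 0 <= tau * tau * (1 + xi) * (1 - xi).
  by rewrite !mulr_ge0//; lra.
have -> : (1 + (r - 1) * tau) * xi + (r - 1) * tau - tau * (1 + xi) * r =
  xi - tau * (1 + xi) by ring.
nra.
Qed.

(** If p were in Q with norm r > n + 1, then Q would contain the convex hull of
    the unit ball and p, hence the ellipsoid centred at (r - 1) tau on the ray
    through p, with semi-axis 1 + (r - 1) tau along p and all other semi-axes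
    sqrt (1 - 2 tau); its volume is larger than that of the unit ball. *)
Lemma john_sub_ball (R : realType) (n : nat) (Q : set 'rV[R]_n.+1)
    (p : 'rV[R]_n.+1) :
  john_position Q -> Q p -> sqn p <= n.+1%:R ^+ 2.
Proof.
move=> [[cQ _ _] [_ BQ maxB]] Qp; rewrite leNgt; apply/negP => pn.
pose r := Num.sqrt (sqn p).
have rn : n.+1%:R < r.
  rewrite -[X in X < _]ger0_norm// -sqrtr_sqr.
  by rewrite ltr_sqrt// (le_lt_trans _ pn)// sqr_ge0.
have r0 : 0 < r by rewrite (le_lt_trans _ rn).
pose tau := (r - n.+1%:R) / (4 * n.+1%:R * r).
have [tau0 tau1 big] := stretched_ellipsoid_bigger rn (erefl tau).
pose a := 1 + (r - 1) * tau; pose b := Num.sqrt (1 - 2 * tau).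
have b0 : 0 < b by rewrite sqrtr_gt0; lra.
have bb : b ^+ 2 = 1 - 2 * tau by rewrite sqr_sqrtr//; lra.
have big' : 1 < a * b ^+ n by [].
have pu : sqn (r^-1 *: p) = 1.
  by rewrite sqnZ exprVn -(sqr_sqrtr (sqn_ge0 p)) -/r mulVf// expf_neq0// gt_eqF.
(* H carries the first coordinate axis to the ray through p, so that the
   ellipsoid has diagonal matrix D in the rotated coordinates. *)
have [H0] := orthogonal_moves_e0 pu.
pose H : 'M[R]_(1 + n) := H0; change H0 with H => -[HH eH].
have pE : p = row_mx (r%:M : 'M[R]_1) 0 *m H.
  rewrite -[LHS](scalerKV (lt0r_neq0 r0)) -eH scalemxAl; congr (_ *m _).
  apply/rowP => i; rewrite !mxE; case: splitP => j ij.
    have -> : i = 0 by apply: val_inj; rewrite /= ij ord1.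
    by rewrite eqxx ord1 mxE mulr1 mulr1n.
  have -> : (i == 0) = false by apply/eqP => i0; move: ij; rewrite i0.
  by rewrite mxE andbF mulr0.
pose D : 'M[R]_(1 + n) := block_mx (a%:M : 'M[R]_1) 0 0 (b%:M : 'M[R]_n).
pose c : 'rV[R]_(1 + n) := row_mx (((r - 1) * tau)%:M : 'M[R]_1) 0 *m H.
pose M : 'M[R]_(1 + n) := D *m H.
have dM : `|\det M| = a * b ^+ n.
  rewrite /M det_mulmx normrM (det_orthogonal HH) mulr1 /D.
  rewrite (@det_ublock _ 1 n) !det_scalar expr1 ger0_norm//.
  by rewrite (le_trans _ (ltW big')).
have Mu : M \in unitmx.
  by rewrite unitmxE unitfE -normr_gt0 dM (lt_trans _ big').
have ballE : unit_ball R n.+1 = affine_ball 1%:M 0 1.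
  apply/seteqP; split => x /=.
    by move=> xb; exists x; rewrite ?mulmx1 ?addr0// /= -unit_ballE.
  by move=> [y /= yb <-]; rewrite mulmx1 addr0 unit_ballE.
have ME : ellipsoid ([set x *m M + c | x in unit_ball R n.+1] : set 'rV[R]_n.+1).
  by exists M, c.
have MQ : [set x *m M + c | x in unit_ball R n.+1] `<=` Q.
  move=> _ [x xb <-].
  move: xb; rewrite unit_ballE.
  rewrite -[x](@hsubmxK _ 1 1 n).
  have -> : lsubmx (x : 'rV_(1 + n)) = (lsubmx (x : 'rV_(1 + n)) 0 0)%:M.
    by apply/matrixP => i j; rewrite !ord1 [RHS]mxE mulr1n.
  move: (lsubmx _ 0 0) (rsubmx _) => xi w {x}; rewrite sqn_row_mx => xw.
  have xi2 : xi ^+ 2 <= 1 by rewrite (le_trans _ xw)// lerDl sqn_ge0.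
  have : `|xi| <= 1.
    by rewrite -(@ler_pXn2r _ 2)// ?nnegrE// expr1n real_normK ?num_real.
  rewrite ler_norml => /andP[xi0 xi1].
  have := stretched_ellipsoid_sub r tau0 tau1 xi0 xi1 xw.
  rewrite -/a; set t := tau * _ => tP.
  have t0 : 0 <= t by rewrite /t mulr_ge0//; [exact: ltW|lra].
  have t1 : t < 1.
    have : 0 <= tau * (1 - xi) by rewrite mulr_ge0//; [exact: ltW|lra].
    rewrite /t; lra.
  have t1' : 0 < 1 - t by rewrite subr_gt0.
  pose z := (1 - t)^-1 *:
    (row_mx ((a * xi + (r - 1) * tau - t * r)%:M : 'M[R]_1) (b *: w) *m H).
  have zB : unit_ball R n.+1 z.
    rewrite unit_ballE sqnZ (sqn_orthogonal _ HH) sqn_row_mx sqnZ bb exprVn mulrC.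
    by rewrite ler_pdivrMr ?exprn_gt0// mul1r.
  suff -> : row_mx (xi%:M : 'M[R]_1) w *m M + c = t *: p + (1 - t) *: z.
    by apply: convex_set_segment => //; [exact: BQ|exact: ltW].
  rewrite /z scalerA divff ?gt_eqF// scale1r pE scalemxAl /M mulmxA -!mulmxDl.
  congr (_ *m _); rewrite /D mul_row_block !mulmx0 addr0 add0r !add_row_mx.
  rewrite scale_row_mx add_row_mx scaler0 addr0 add0r !mul_mx_scalar; congr row_mx.
  by apply/matrixP => i j; rewrite !ord1 !mxE !mulr1n; ring.
have := maxB _ ME MQ.
have [k k0 kE] := volume_affine_ball R n.+1.
rewrite (_ : [set x *m M + c | x in _] = affine_ball M c 1); last first.
  by rewrite /affine_ball; congr image; apply/funext => x; rewrite unit_ballE.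
rewrite ballE !kE ?unitmx1// lee_fin dM det1 normr1.
rewrite /radial_volume ltr10 sqrtr1 expr1n !mulr1 ler_pM2r//.
by rewrite leNgt big'.
Qed.

(** * Convex combinations *)

(** Partial sums are normalised by their total weight, which makes the statement
    inductive; points of weight zero are unconstrained, so that C only has to
    contain the points in the support of the weights. *)
Lemma convex_comb (R : realType) (n : nat) (C : set 'rV[R]_n) (I : finType)
    (a : I -> R) (x : I -> 'rV[R]_n) :
  convex_set (C : set (convex_lmodType 'rV[R]_n)) ->
  (forall i, 0 <= a i) -> (forall i, a i != 0 -> C (x i)) ->
  \sum_i a i = 1 -> C (\sum_i a i *: x i).
Proof.
move=> cC a0 Cx a1.
suff H (r : seq I) : \sum_(i <- r) a i != 0 ->
    C ((\sum_(i <- r) a i)^-1 *: \sum_(i <- r) a i *: x i).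
  by have := H (index_enum I); rewrite a1 invr1 scale1r; apply; exact: oner_neq0.
elim: r => [|i r IH]; first by rewrite big_nil eqxx.
rewrite !big_cons; set s := \sum_(j <- r) a j; set y := \sum_(j <- r) _.
have s0 : 0 <= s by exact: sumr_ge0.
have [ai0|ai0] := eqVneq (a i) 0.
  by rewrite ai0 !add0r scale0r add0r; exact: IH.
have ai : 0 < a i by rewrite lt_def ai0 a0.
have [sz|sn0] := eqVneq s 0.
  have -> : y = 0.
    rewrite /y big_seq big1// => j jr.
    move: sz => /eqP; rewrite psumr_eq0// => /allP/(_ j jr)/= /eqP->.
    by rewrite scale0r.
  by rewrite sz !addr0 scalerA mulVf// scale1r => _; exact: Cx.
move=> _; have sp : 0 < a i + s by exact: ltr_wpDr.
have := @convex_set_segment R n C cC (x i) (s^-1 *: y) (a i / (a i + s))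
  (Cx _ ai0) (IH sn0).
rewrite divr_ge0 ?(ltW sp)// ler_pdivrMr// mul1r lerDl => /(_ isT s0).
rewrite scalerA scalerDr scalerA.
have -> : (1 - a i / (a i + s)) * s^-1 = (a i + s)^-1.
  by field; rewrite sn0 gt_eqF.
by rewrite (mulrC (a i)).
Qed.

(** As 0 is in C, a nonnegative combination of total weight at most T becomes T
    times a convex combination once the missing weight is put on 0. *)
Lemma convex_cone_comb (R : realType) (n : nat) (C : set 'rV[R]_n) (I : finType)
    (a : I -> R) (x : I -> 'rV[R]_n) (T : R) :
  convex_set (C : set (convex_lmodType 'rV[R]_n)) -> C 0 ->
  (forall i, 0 <= a i) -> (forall i, a i != 0 -> C (x i)) ->
  \sum_i a i <= T -> 0 < T -> exists2 y, C y & \sum_i a i *: x i = T *: y.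
Proof.
move=> cC C0 a0 Cx aT T0.
set s := \sum_i a i in aT *; have s0 : 0 <= s by exact: sumr_ge0.
have [sz|sn0] := eqVneq s 0.
  exists 0 => //; rewrite scaler0 big1// => i _.
  move: sz => /eqP; rewrite psumr_eq0// => /allP/(_ i (mem_index_enum i))/= /eqP->.
  by rewrite scale0r.
have Cz : C (\sum_i (a i / s) *: x i).
  apply: convex_comb => //.
  - by move=> i; rewrite divr_ge0.
  - by move=> i; rewrite mulf_eq0 negb_or => /andP[/Cx].
  - by rewrite -mulr_suml divff.
exists (s / T *: (\sum_i (a i / s) *: x i) + (1 - s / T) *: 0).
  apply: convex_set_segment => //; first by rewrite divr_ge0// ltW.
  by rewrite ler_pdivrMr// mul1r.
rewrite scaler0 addr0 scalerA scaler_sumr; apply: eq_bigr => i _.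
by rewrite scalerA; congr (_ *: _); field; rewrite sn0 gt_eqF.
Qed.

Definition stochastic (R : realType) (k : nat) (a : 'rV[R]_k) : Prop :=
  (forall i, 0 <= a 0 i) /\ \sum_i a 0 i = 1.

Definition row_hull (R : realType) (k n : nat) (A : 'M[R]_(k, n)) : set 'rV[R]_n :=
  [set a *m A | a in @stochastic R k].

Lemma stochastic_comb (R : realType) (k : nat) (a b : 'rV[R]_k) (t : R) :
  0 <= t -> t <= 1 -> stochastic a -> stochastic b ->
  stochastic (t *: a + (1 - t) *: b).
Proof.
move=> t0 t1 [a0 a1] [b0 b1]; split.
  by move=> i; rewrite !mxE addr_ge0// mulr_ge0// subr_ge0.
under eq_bigr do rewrite !mxE.
by rewrite big_split/= -!mulr_sumr a1 b1 !mulr1 addrC subrK.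
Qed.

Lemma stochastic_delta (R : realType) (k : nat) (i : 'I_k) :
  stochastic (delta_mx 0 i : 'rV[R]_k).
Proof.
split=> [j|]; first by rewrite mxE.
by rewrite (bigD1 i)//= big1 ?mxE ?eqxx ?addr0// => j ji; rewrite mxE (negbTE ji).
Qed.

Lemma row_hull_row (R : realType) (k n : nat) (A : 'M[R]_(k, n)) (i : 'I_k) :
  row_hull A (row i A).
Proof. by exists (delta_mx 0 i); [exact: stochastic_delta|rewrite -rowE]. Qed.

Lemma row_hull_convex (R : realType) (k n : nat) (A : 'M[R]_(k, n)) :
  convex_set (row_hull A : set (convex_lmodType 'rV[R]_n)).
Proof.
move=> x y l /set_mem[a sa <-] /set_mem[b sb <-]; apply/mem_set.
exists (l%:num *: a + (1 - l%:num) *: b).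
  by apply: stochastic_comb sa sb; rewrite ?ge0 ?le1.
by rewrite mulmxDl -!scalemxAl.
Qed.

Lemma row_hull_sub (R : realType) (k n : nat) (A : 'M[R]_(k, n)) (C : set 'rV[R]_n) :
  convex_set (C : set (convex_lmodType 'rV[R]_n)) ->
  (forall i, C (row i A)) -> row_hull A `<=` C.
Proof.
move=> cC CA _ [a [a0 a1] <-]; rewrite mulmx_sum_row.
exact: convex_comb.
Qed.

Lemma convex_hull_convex (R : realType) (n : nat) (V : set 'rV[R]_n) :
  convex_set (convex_hull V : set (convex_lmodType 'rV[R]_n)).
Proof.
move=> x y l /set_mem xV /set_mem yV; apply/mem_set => C [cC VC].
by apply/set_mem; apply: (cC); apply/mem_set; [exact: xV|exact: yV].
Qed.

Lemma sub_convex_hull (R : realType) (n : nat) (V : set 'rV[R]_n) :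
  V `<=` convex_hull V.
Proof. exact: sub_smallest. Qed.

Lemma polytope_row_hull (R : realType) (n : nat) (Q : set 'rV[R]_n) :
  polytope Q -> exists k (A : 'M[R]_(k, n)), Q = row_hull A.
Proof.
move=> [V /finite_seqP[s ->] ->].
exists (size s), (\matrix_(i < size s) nth 0 s i); apply/seteqP; split.
  apply: smallest_sub; first exact: row_hull_convex.
  move=> x /= xs; have i := xs; rewrite -index_mem in i.
  have -> : x = row (Ordinal i) (\matrix_(j < size s) nth 0 s j).
    by rewrite rowK /= nth_index.
  exact: row_hull_row.
apply: row_hull_sub; first exact: convex_hull_convex.
by move=> i; rewrite rowK; apply: sub_convex_hull; rewrite /= mem_nth.
Qed.

(** * Vertices, maximal determinants and conic combinations *)

(** If the i-th row were a proper convex combination of points of the hull, its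
    own coefficient in the resulting expression in the rows would be less than 1;
    solving for it exhibits the row as a convex combination of the other rows, so
    that it could be dropped. *)
Lemma minimal_row_hull_vertex (R : realType) (k n : nat) (A : 'M[R]_(k, n)) :
  (forall k' (B : 'M[R]_(k', n)), row_hull B = row_hull A -> (k <= k')%N) ->
  forall i, vertices (row_hull A) (row i A).
Proof.
move=> kmin i; split; first exact: row_hull_row.
move=> x y t [a sa <-] [b sb <-] t0 t1 vE.
have [a0 a1] := sa; have [b0 b1] := sb.
have sc := stochastic_comb (ltW t0) (ltW t1) sa sb.
set c := t *: a + (1 - t) *: b in sc.
have vc : row i A = c *m A by rewrite vE mulmxDl -!scalemxAl.
have stoch_le1 (e : 'rV[R]_k) : stochastic e -> e 0 i <= 1.
  by move=> [e0 <-]; rewrite (bigD1 i)//= lerDl sumr_ge0.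
have stoch1 (e : 'rV[R]_k) : stochastic e -> e 0 i = 1 -> e *m A = row i A.
  move=> [e0 e1] ei; rewrite rowE; congr (_ *m _); apply/rowP => j.
  rewrite mxE eqxx/=; have [->//|ji] := eqVneq j i.
  have /eqP : \sum_(l | l != i) e 0 l = 0.
    move: e1; rewrite (bigD1 i)//= ei => /eqP.
    by rewrite eq_sym addrC -subr_eq subrr => /eqP.
  by rewrite psumr_eq0// => /allP/(_ j (mem_index_enum j)); rewrite ji => /eqP.
have [c1|cn1] := eqVneq (c 0 i) 1.
  have := stoch_le1 a sa; have := stoch_le1 b sb => bi ai.
  have ce : t * a 0 i + (1 - t) * b 0 i = 1 by move: c1; rewrite !mxE.
  have p1 : 0 <= t * (1 - a 0 i) by rewrite mulr_ge0 ?subr_ge0// ltW.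
  have p2 : 0 <= (1 - t) * (1 - b 0 i) by rewrite mulr_ge0 ?subr_ge0// ltW.
  have z1 : t * (1 - a 0 i) = 0 by lra.
  have z2 : (1 - t) * (1 - b 0 i) = 0 by lra.
  split; apply: stoch1 => //; apply/eqP; rewrite eq_sym -subr_eq0.
    by move/eqP: z1; rewrite mulf_eq0 (gt_eqF t0).
  have t1' : 0 < 1 - t by rewrite subr_gt0.
  by move/eqP: z2; rewrite mulf_eq0 (gt_eqF t1').
exfalso; have [c0 cs] := sc.
have w0 : 0 < 1 - c 0 i by rewrite subr_gt0 lt_neqAle cn1 stoch_le1.
have rowB j : j != i -> row_hull (row' i A) (row j A).
  case: (unliftP i j) => [j' ->|->]; last by rewrite eqxx.
  move=> _; have -> : row (lift i j') A = row j' (row' i A).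
    by apply/rowP => l; rewrite !mxE.
  exact: row_hull_row.
have wE : \sum_(j | j != i) c 0 j = 1 - c 0 i.
  by rewrite -cs [in RHS](bigD1 i)//= addrAC subrr add0r.
have rowBi : row_hull (row' i A) (row i A).
  have -> : row i A = \sum_j (if j == i then 0 else c 0 j / (1 - c 0 i)) *: row j A.
    rewrite (bigD1 i)//= eqxx scale0r add0r.
    apply: (scalerI (lt0r_neq0 w0)); rewrite scaler_sumr scalerBl scale1r.
    rewrite {1}vc mulmx_sum_row (bigD1 i)//= addrAC subrr add0r; apply: eq_bigr => j ji.
    by rewrite (negbTE ji) scalerA mulrC divfK// gt_eqF.
  apply: convex_comb; first exact: row_hull_convex.
  - by move=> j; case: eqP => // _; rewrite divr_ge0// ltW.
  - by move=> j; case: (eqVneq j i) => [_|ji _]; [rewrite eqxx|exact: rowB].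
  - rewrite (bigD1 i)//= eqxx add0r (eq_bigr (fun j => c 0 j / (1 - c 0 i))).
      by rewrite -mulr_suml wE divff// gt_eqF.
    by move=> j /negbTE->.
have /kmin : row_hull (row' i A) = row_hull A.
  apply/seteqP; split; apply: row_hull_sub; try exact: row_hull_convex.
    move=> j; have -> : row j (row' i A) = row (lift i j) A.
      by apply/rowP => l; rewrite !mxE.
    exact: row_hull_row.
  by move=> j; have [->//|] := eqVneq j i; exact: rowB.
by rewrite leqNgt ltn_predL (leq_ltn_trans _ (ltn_ord i)).
Qed.

Lemma polytope_vertex_matrix (R : realType) (n : nat) (Q : set 'rV[R]_n) :
  polytope Q -> exists k (A : 'M[R]_(k, n)),
  Q = row_hull A /\ forall i, vertices Q (row i A).
Proof.
move=> /polytope_row_hull pQ.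
have {}pQ : exists k, `[< exists A : 'M[R]_(k, n), Q = row_hull A >].
  by have [k kA] := pQ; exists k; apply/asboolP.
case: (ex_minnP pQ) => k /asboolP[A QA] kmin; exists k, A; split => //.
rewrite QA; apply: minimal_row_hull_vertex => k' B BA.
by apply: kmin; apply/asboolP; exists B; rewrite QA.
Qed.

(** The rows selected by f maximise the absolute value of the determinant. By
    Cramer's rule the i-th coordinate of a row of A in the basis of the selected
    rows is the ratio of the determinant after replacing the i-th selected row to
    the original determinant. *)
Lemma max_det_parallelotope (R : realType) (k n : nat) (A : 'M[R]_(k, n)) :
  row_full A -> exists f : {ffun 'I_n -> 'I_k},
  rowsub f A \in unitmx /\
  forall j i, `|(row j A *m invmx (rowsub f A)) 0 i| <= 1.
Proof.
move=> Afull.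
pose f0 : {ffun 'I_n -> 'I_k} := fullrankfun Afull.
have f0u : rowsub f0 A \in unitmx by exact: fullrowsub_unit.
pose F (f : {ffun 'I_n -> 'I_k}) := `|\det (rowsub f A)|.
case: (@arg_maxP _ _ _ f0 xpredT F) => // f _ fmax; exists f.
have det0 : 0 < F f.
  by apply: lt_le_trans (fmax f0 isT); rewrite /F normr_gt0 -unitfE -unitmxE.
have fu : rowsub f A \in unitmx by rewrite unitmxE unitfE -normr_gt0.
split=> // j i; set D := rowsub f A in det0 fu *.
pose g : {ffun 'I_n -> 'I_k} := [ffun l => if l == i then j else f l].
have -> : (row j A *m invmx D) 0 i = (\det D)^-1 * \det (rowsub g A).
  rewrite /invmx fu -scalemxAr mxE; congr (_ * _).
  rewrite mxE (expand_det_row _ i); apply: eq_bigr => l _.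
  rewrite !mxE ffunE eqxx; congr (_ * _); rewrite /cofactor; congr (_ * \det _).
  by apply/matrixP => u v; rewrite !mxE ffunE eq_sym (negbTE (neq_lift _ _)).
rewrite normrM normfV mulrC ler_pdivrMr// mul1r.
exact: fmax.
Qed.

(** As long as more than n coefficients are nonzero, the corresponding rows are
    linearly dependent. Up to sign, the dependency has nonnegative coefficient
    sum, hence a positive coefficient; subtracting the largest multiple that
    keeps all coefficients nonnegative removes a row from the support and
    does not increase the total weight. *)
Lemma conic_caratheodory (R : realType) (k n : nat) (A : 'M[R]_(k, n))
    (a : 'rV[R]_k) :
  (forall i, 0 <= a 0 i) -> exists b : 'rV[R]_k,
  [/\ forall i, 0 <= b 0 i, b *m A = a *m A, \sum_i b 0 i <= \sum_i a 0 i
    & (#|[set i | b 0%R i != 0%R]%SET| <= n)%N].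
Proof.
have [m] := ubnP #|[set i | a 0%R i != 0%R]%SET|.
elim: m a => // m IH a am a0; have [an|na] := leqP #|[set i | a 0%R i != 0%R]%SET| n.
  by exists a.
set S := [set i | a 0%R i != 0%R]%SET in am na.
pose B := rowsub (@enum_val _ (mem S)) A.
have Bker : kermx B != 0.
  rewrite -mxrank_eq0 mxrank_ker subn_eq0 -ltnNge.
  exact: leq_ltn_trans (rank_leq_col B) na.
have [u uB u0] := rowV0Pn Bker.
have {}uB : u *m B = 0 by exact/sub_kermxP.
wlog us : u uB u0 / 0 <= \sum_i u 0 i.
  move=> W; have [|us] := leP 0 (\sum_i u 0 i); first exact: W.
  apply: (W (- u)); first by rewrite mulNmx uB oppr0.
    by rewrite oppr_eq0.
  by under eq_bigr do rewrite mxE; rewrite sumrN oppr_ge0 ltW.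
(* c is u, extended by zero outside of S. *)
pose c : 'rV[R]_k := \row_i \sum_(j | enum_val j == i) u 0 j.
have cE j : c 0 (enum_val j) = u 0 j.
  by rewrite mxE (big_pred1 j)// => l; rewrite (inj_eq enum_val_inj).
have cS i : i \notin S -> c 0 i = 0.
  move=> iS; rewrite mxE big_pred0// => j; apply: contraNF iS => /eqP<-.
  exact: enum_valP.
clearbody c.
have cA : c *m A = 0.
  rewrite -uB; apply/rowP => l; rewrite !mxE.
  rewrite (bigID (mem S))/= [X in _ + X]big1 ?addr0; last first.
    by move=> i iS; rewrite cS// mul0r.
  rewrite (big_enum_val (fun i => c 0 i * A i l)).
  by apply: eq_bigr => j _; rewrite cE mxE.
have csum : \sum_i c 0 i = \sum_j u 0 j.
  rewrite (bigID (mem S))/= [X in _ + X]big1 ?addr0//.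
  rewrite (big_enum_val (fun i => c 0 i)).
  by apply: eq_bigr => j _; rewrite cE.
have [i0 ci0] : exists i, 0 < c 0 i.
  apply: contrapT => /forallNP cn.
  have {}cn i : c 0 i <= 0 by rewrite leNgt; exact/negP.
  move/eqP: u0; apply; apply/rowP => j; rewrite mxE -cE.
  have : \sum_i - c 0 i = 0.
    apply: le_anti; rewrite {1}sumrN oppr_le0 csum us/=.
    by apply: sumr_ge0 => i _; rewrite oppr_ge0.
  move=> /eqP; rewrite psumr_eq0; last by move=> i _; rewrite oppr_ge0.
  by move=> /allP/(_ (enum_val j) (mem_index_enum _)); rewrite oppr_eq0 => /eqP.
case: (@arg_minP _ _ _ i0 (fun i => 0 < c 0 i) (fun i => a 0 i / c 0 i)) => //.
move=> i1 ci1 imin; set th := a 0 i1 / c 0 i1 in imin.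
have th0 : 0 <= th by rewrite divr_ge0// ltW.
have [||b [b0 bA ba bn]] := IH (a - th *: c).
- rewrite -ltnS; apply: leq_trans am; rewrite ltnS.
  apply: proper_card; apply/properP; split.
    apply/fintype.subsetP => i; rewrite !inE; apply: contra_neq => ai.
    by rewrite !mxE ai sub0r cS ?inE ?ai ?eqxx// mulr0 oppr0.
  exists i1; last by rewrite inE !mxE /th divfK ?subrr ?eqxx// gt_eqF.
  by apply: contraTT ci1 => /cS->; rewrite ltxx.
- move=> i; rewrite !mxE subr_ge0; have [ci|ci] := ltP 0 (c 0 i).
    by rewrite -ler_pdivlMr//; exact: imin.
  by apply: le_trans (a0 i); rewrite mulr_ge0_le0.
exists b; split=> //; first by rewrite bA mulmxBl -scalemxAl cA scaler0 subr0.
apply: le_trans ba _; under eq_bigr do rewrite !mxE.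
by rewrite sumrB -mulr_sumr csum gerBl mulr_ge0.
Qed.

(** * Sparse subsets of the vertices *)

Lemma card_image_finset_le (T : Type) (I : finType) (S : {set I}) (f : I -> T)
    (m : nat) :
  (#|S| <= m)%N -> (f @` [set i | i \in S] #<= `I_m)%card.
Proof.
move=> Sm; apply: card_le_trans (card_image_le f _) _.
apply: (@card_le_trans _ _ _ `I_#|S|); last by rewrite card_le_II.
case: (set_0Vmem S) => [->|[i0 _]].
  rewrite (_ : [set i | i \in _] = set0) ?card_ge0//.
  by apply/seteqP; split=> i //=; rewrite inE.
apply: card_le_trans (card_image_le (fun j => nth i0 (enum S) j) _).
apply: subset_card_le => i /= iS; exists (index i (enum S)).
  by rewrite /= cardE index_mem mem_enum.
by rewrite nth_index// mem_enum.
Qed.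

(** The selected rows are the n + 1 rows v_i that maximise the determinant,
    together with the at most n + 1 rows w_j that carry
    q = - (1 / (lam (n + 1))) sum_i v_i as a combination sum_j b_j w_j of total
    weight at most 1. Since q is a negative multiple of the sum of the v_i, the
    convex hull of the selected rows contains 0. A point x = sum_i be_i v_i of
    the hull, where |be_i| <= 1, is written with m = max (0, max_i be_i) as
    - (sum_i (m - be_i) v_i + m lam (n + 1) sum_j b_j w_j). All coefficients are
    nonnegative and add up to at most 2 n + lam (n + 1), because the term
    m - be_i vanishes at the maximum if m > 0. *)
Lemma sparse_reflected_hull (R : realType) (k n : nat) (A : 'M[R]_(k, n.+1))
    (lam T : R) :
  row_full A -> 1 <= lam ->
  (forall x, row_hull A x -> row_hull A (- lam^-1 *: x)) ->
  2 * n%:R + lam * n.+1%:R <= T ->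
  exists2 S : {set 'I_k}, (#|S| <= 2 * n.+1)%N &
  row_hull A `<=` dilate (- T)
    (convex_hull ((fun i => row i A) @` [set i | i \in S])).
Proof.
move=> Afull lam1 Alam lamT.
have lam0 : 0 < lam by exact: lt_le_trans lam1.
have d0 : 0 < n.+1%:R :> R by [].
have [f [fu fA]] := max_det_parallelotope Afull.
set D := rowsub f A in fu fA.
pose g := \sum_i row (f i) A.
have [e [e0 e1] eq] : row_hull A (- lam^-1 *: (n.+1%:R^-1 *: g)).
  apply: Alam; rewrite /g scaler_sumr; apply: convex_comb.
  - exact: row_hull_convex.
  - by move=> i; rewrite invr_ge0.
  - by move=> i _; exact: row_hull_row.
  - by rewrite sumr_const card_ord -[X in X = _]mulr_natr mulVf// gt_eqF.
have [b [b0 bA b1 bS]] := conic_caratheodory A e0.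
rewrite e1 in b1; rewrite eq scalerA in bA.
have gE : g = - (lam * n.+1%:R) *: (b *m A).
  rewrite bA scalerA (_ : _ * _ = 1) ?scale1r//.
  by field; rewrite !gt_eqF//; lra.
pose S := (f @: [set: 'I_n.+1] :|: [set j | b 0%R j != 0%R])%SET.
exists S.
  apply: leq_trans (leq_card_setU _ _) _; rewrite mul2n -addnn leq_add//.
  by apply: leq_trans (leq_imset_card _ _) _; rewrite cardsT card_ord.
set C := convex_hull _.
have cC : convex_set (C : set (convex_lmodType 'rV[R]_n.+1)).
  exact: convex_hull_convex.
have CS j : j \in S -> C (row j A) by move=> jS; apply: sub_convex_hull; exists j.
pose v (o : 'I_n.+1 + 'I_k) := match o with inl i => row (f i) A | inr j => row j A end.
have vC (c : 'I_n.+1 -> R) (m : R) o :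
    (match o with inl i => c i | inr j => m * b 0 j end) != 0 -> C (v o).
  case: o => [i _|j] /=; first by apply: CS; rewrite !inE imset_f.
  by rewrite mulf_eq0 negb_or => /andP[_ bj]; apply: CS; rewrite !inE bj orbT.
have C0 : C 0.
  (* With g = sum_i v_i: the convex combination is a multiple of g / (n + 1) + lam q,
     and s is its normalising constant. *)
  pose s := 1 + lam * \sum_j b 0 j.
  have s0 : 0 < s by rewrite ltr_pwDl// mulr_ge0 ?sumr_ge0// ltW.
  pose w (o : 'I_n.+1 + 'I_k) :=
    match o with inl i => (n.+1%:R * s)^-1 | inr j => lam / s * b 0 j end.
  have -> : 0 = \sum_o w o *: v o.
    rewrite big_sumType/= -scaler_sumr -/g gE.
    under [X in _ + X]eq_bigr do rewrite -scalerA.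
    rewrite -scaler_sumr -mulmx_sum_row scalerA -scalerDl.
    rewrite (_ : _ + _ = 0) ?scale0r//.
    by field; rewrite !gt_eqF//; lra.
  apply: convex_comb => //.
  - by case=> [i|j] /=; rewrite ?invr_ge0 ?mulr_ge0// ?invr_ge0 ltW.
  - exact: vC.
  - rewrite big_sumType/= sumr_const card_ord -mulr_sumr -[X in X + _]mulr_natr /s.
    by field; rewrite -/s !gt_eqF//; lra.
move=> _ [a [a0 a1] <-].
pose be := a *m A *m invmx D.
have beE : a *m A = \sum_i be 0 i *: row (f i) A.
  rewrite -[LHS](mulmxKV fu) mulmx_sum_row; apply: eq_bigr => i _; congr (_ *: _).
  by apply/rowP => j; rewrite !mxE.
have be1 i : `|be 0 i| <= 1.
  rewrite /be (mulmx_sum_row a A) mulmx_suml summxE.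
  apply: (le_trans (ler_norm_sum _ _ _)); rewrite -a1; apply: ler_sum => j _.
  by rewrite -scalemxAl mxE normrM ger0_norm// ler_piMr.
case: (@arg_maxP _ _ _ ord0 xpredT (fun i => be 0 i)) => // i0 _ bemax0.
have bemax i : be 0 i <= be 0 i0 by exact: bemax0.
pose m := Num.max 0 (be 0 i0).
have m0 : 0 <= m by rewrite le_max lexx.
have m1 : m <= 1 by rewrite ge_max ler01 (le_trans (ler_norm _)).
have mbe i : 0 <= m - be 0 i by rewrite subr_ge0 le_max bemax// orbT.
have bem i : m - be 0 i <= 2.
  by have := be1 i; rewrite ler_norml => /andP[]; lra.
pose w (o : 'I_n.+1 + 'I_k) :=
  match o with inl i => m - be 0 i | inr j => m * (lam * n.+1%:R) * b 0 j end.
have T0 : 0 < T by apply: lt_le_trans lamT; rewrite ltr_pwDr ?mulr_gt0// mulr_ge0.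
have [||y Cy yE] := @convex_cone_comb R n.+1 C _ w v T cC C0 _ (@vC _ _) _ T0.
- case=> [i|j] //=; rewrite !mulr_ge0//; exact: ltW.
- rewrite big_sumType/= -mulr_sumr (bigD1 i0)//=.
  apply: le_trans lamT.
  have h1 : \sum_(i | i != i0) (m - be 0 i) <= 2 * n%:R.
    apply: (@le_trans _ _ (\sum_(i < n.+1 | i != i0) 2)); first exact: ler_sum.
    by rewrite sumr_const cardC1 card_ord /= mulr_natr.
  have h2 : m * (lam * n.+1%:R) * (\sum_j b 0 j) <= m * (lam * n.+1%:R).
    by rewrite ler_piMr// !mulr_ge0// ltW.
  have h3 : m - be 0 i0 + m * (lam * n.+1%:R) <= lam * n.+1%:R.
    have p1 : 1 <= lam * n.+1%:R.
      by rewrite (le_trans lam1)// ler_peMr ?(ltW lam0)// ler1n.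
    rewrite /m; case: (leP 0 (be 0 i0)) => be0.
      rewrite subrr add0r ler_piMl// ?(le_trans _ p1)//.
      by rewrite (le_trans (ler_norm _)).
    by have := be1 i0; rewrite ler_norml => /andP[]; lra.
  lra.
exists y => //; rewrite scaleNr -yE big_sumType/=.
under [X in _ + X]eq_bigr do rewrite -scalerA.
rewrite -scaler_sumr -mulmx_sum_row -scalerA beE.
under eq_bigr do rewrite scalerBl.
rewrite sumrB -scaler_sumr -/g {1}gE scaleNr scalerN opprD opprB.
by rewrite opprK addrK.
Qed.

Unset Implicit Arguments.

Theorem corollary3 (R : realType) (d : nat) (hd : (1 <= d)%N)
    (Q : set 'rV[R]_d) (hQ : polytope Q) (hJ : john_position Q) :
  exists V : set 'rV[R]_d,
    [/\ V `<=` vertices Q,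
        (V #<= `I_(2 * d))%card
      & Q `<=` dilate (- (2 * d%:R ^+ 2)) (convex_hull V)].
Proof.
case: d hd Q hQ hJ => // n _ Q hQ hJ.
have [k [A [QA Avert]]] := polytope_vertex_matrix hQ.
have BQ : unit_ball R n.+1 `<=` Q by case: hJ => _ [].
have d1 : 1 <= n.+1%:R :> R by rewrite ler1n.
have [||||S Scard QS] := @sparse_reflected_hull R k n A n.+1%:R (2 * n.+1%:R ^+ 2).
- rewrite -sub1mx; apply/row_subP => i; rewrite row1.
  have : Q (delta_mx 0 i).
    apply: BQ; rewrite unit_ballE sqnE trmx_delta mul_delta_mx mxE.
    by rewrite !eqxx.
  by rewrite QA => -[a _ <-]; exact: submxMl.
- by [].
- rewrite -QA => x Qx; apply: BQ; rewrite unit_ballE sqnZ sqrrN exprVn mulrC.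
  by rewrite ler_pdivrMr ?exprn_gt0// mul1r; exact: john_sub_ball hJ Qx.
- rewrite -natr1; have : 0 <= n%:R ^+ 2 :> R by exact: sqr_ge0.
  lra.
exists ((fun i => row i A) @` [set i | i \in S]); split.
- by move=> _ [i _ <-].
- exact: card_image_finset_le.
- by rewrite {1}QA.
Qed.
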